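(* Let $m$ be the Haar (normalized arc-length) measure on $\mathbb{T}$ and let $\mu\in\mathcal{M}_{\mathbb{T}}$ with $\int_{\mathbb{T}}\zeta\,d\mu(\zeta)\ne0$ be such that the pair $(\mu,m)$ is $\boxtimes$-infinitely divisible. Then $\mu$ is either a point mass $\delta_\lambda$ for some $\lambda\in\mathbb{T}$, or the harmonic measure for the unit disk $\mathbb{D}$ relative to some point $\alpha\in\mathbb{D}\setminus\{0\}$, i.e. $d\mu=P_\alpha\,dm$, where $P_\alpha$ is the Poisson kernel at $\alpha$.
   Context: $\mathbb{T}$ is the unit circle, $\mathcal{M}_{\mathbb{T}}$ is the set of Borel probability measures on $\mathbb{T}$, and $P_\alpha(\zeta)=\frac{1-|\alpha|^2}{|\zeta-\alpha|^2}$. c-freeness: let $\mathcal{A}$ be a unital algebra with normalized linear functionals $\varphi,\psi$ ($\varphi(1)=\psi(1)=1$). Elements $X,Y\in\mathcal{A}$ are c-free if the unital subalgebras $\mathcal{A}_1,\mathcal{A}_2$ they generate satisfy: whenever $a_j\in\mathcal{A}_{\varepsilon(j)}$, $\varepsilon(j)\in\{1,2\}$, $\varepsilon(1)\ne\varepsilon(2)\ne\dots\ne\varepsilon(n)$ (consecutive indices differ) and $\psi(a_j)=0$ for all $j$, one has $\psi(a_1\cdots a_n)=0$ and $\varphi(a_1\cdots a_n)=\varphi(a_1)\cdots\varphi(a_n)$. An element $X$ has distribution $(\mu,\nu)$ if $\varphi(X^n)=\int\zeta^n d\mu(\zeta)$ and $\psi(X^n)=\int\zeta^nd\nu(\zeta)$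 for all $n\ge1$. The multiplicative c-free convolution $(\mu_1,\nu_1)\boxtimes(\mu_2,\nu_2)\in\mathcal{M}_{\mathbb{T}}\times\mathcal{M}_{\mathbb{T}}$ is the distribution of $XY$, where $X,Y$ are c-free with distributions $(\mu_1,\nu_1)$ and $(\mu_2,\nu_2)$. A pair $(\mu,\nu)\in\mathcal{M}_{\mathbb{T}}\times\mathcal{M}_{\mathbb{T}}$ is $\boxtimes$-infinitely divisible if for every $n\in\mathbb{N}$ there is $(\mu_n,\nu_n)\in\mathcal{M}_{\mathbb{T}}\times\mathcal{M}_{\mathbb{T}}$ with $(\mu,\nu)=(\mu_n,\nu_n)\boxtimes\cdots\boxtimes(\mu_n,\nu_n)$ ($n$ times). *)

(* Defs.v *)
From HB Require Import structures.
From mathcomp Require Import all_boot all_order all_algebra.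
From mathcomp Require Import all_classical all_reals all_analysis.
From mathcomp Require Import complex.

Set Implicit Arguments.
Unset Strict Implicit.
Unset Printing Implicit Defensive.

Import Order.TTheory GRing.Theory Num.Theory.
Import numFieldNormedType.Exports.

Local Open Scope classical_set_scope.
Local Open Scope complex_scope.
Local Open Scope ring_scope.

(* The cast to [numFieldType] selects the norm topology of the complex plane;
   [circle] then inherits the subspace topology as a [set_type]. *)
Definition circle_set (R : realType) : set (R[i] : numFieldType) :=
  [set z | `|z| = 1].
Arguments circle_set : clear implicits.

Definition circle (R : realType) : Type := circle_set R.

HB.instance Definition _ (R : realType) :=
  Topological.copy (circle R) (set_type (circle_set R)).

Definition cval (R : realType) (z : circle R) : R[i] := val z.

Lemma expi_subproof (R : realType) (t : R) :
  (cos t +i* sin t : (R[i] : numFieldType)) \in circle_set R.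
Proof. by rewrite inE /circle_set /= normc_def/= cos2Dsin2 sqrtr1. Qed.

Definition expi (R : realType) (t : R) : circle R :=
  exist _ (cos t +i* sin t) (expi_subproof t).

HB.instance Definition _ (R : realType) := isPointed.Build (circle R) (expi 0).

Notation borel_circle R := (g_sigma_algebraType (@open (circle R))).

Notation circle_prob R := (probability (borel_circle R) R).

Lemma continuous_complex (R : realType) (f g : R -> R) :
  continuous f -> continuous g ->
  continuous (fun t => f t +i* g t : (R[i] : numFieldType)).
Proof.
move=> cf cg t; apply/cvgrPdist_lt => e e0.
have [d d0 eE] : exists2 d : R, 0 < d & e = d%:C.
  case: e e0 => a b; rewrite ltcE/= => /andP[/eqP b0 a0].
  by exists a => //; rewrite b0.
have d20 : 0 < d / 2 by rewrite divr_gt0.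
move/cvgrPdist_lt : (cf t) => /(_ _ d20) Hf.
move/cvgrPdist_lt : (cg t) => /(_ _ d20) Hg.
near=> s.
have -> : (f t +i* g t) - (f s +i* g s)
    = (f t - f s)%:C + (0 +i* (g t - g s)) :> R[i].
  by apply/eqP; rewrite eq_complex/= addr0 add0r !eqxx.
apply: le_lt_trans (ler_normD _ _) _.
rewrite !normc_def/= expr0n/= addr0 add0r !sqrtr_sqr eE -rmorphD/= ltcR.
rewrite [ltRHS](splitr d); apply: ltrD; near: s.
- exact: Hf.
- exact: Hg.
Unshelve. all: by end_near. Qed.

Lemma continuous_expi (R : realType) : continuous (@expi R).
Proof.
apply/continuousP => _ [U oU <-].
have /continuousP/(_ _ oU) := continuous_complex (@continuous_cos R)
  (@continuous_sin R).
by [].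
Qed.

Definition borel_expi (R : realType) (t : measurableTypeR R) : borel_circle R :=
  expi t.

Lemma measurable_borel_expi (R : realType) :
  measurable_fun setT (@borel_expi R).
Proof.
apply: (@measurability _ _ (measurableTypeR R) (borel_circle R) setT
  (@borel_expi R) (@open (circle R))) => //.
move=> _ [U oU <-]; rewrite setTI.
apply: measurable_realfun.open_measurable.
by move/continuousP : (@continuous_expi R); exact.
Qed.

HB.instance Definition _ (R : realType) :=
  isMeasurableFun.Build _ _ (measurableTypeR R) (borel_circle R)
    (@borel_expi R) (@measurable_borel_expi R).

Lemma two_pi_gt0 (R : realType) : 0 < 2 * pi :> R.
Proof. by rewrite mulr_gt0// pi_gt0. Qed.

(* Normalized arc length: the law of [expi t] for [t] uniform on [0, 2 pi]. *)
Definition haar (R : realType) : circle_prob R :=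
  distribution (uniform_prob (two_pi_gt0 R)) (@borel_expi R).
Arguments haar : clear implicits.

(* The mass that a [probability] gives to a non-measurable set is junk, so
   measures are compared on Borel sets only. *)
Definition measure_eq (R : realType) (mu nu : set (borel_circle R) -> \bar R) :=
  forall E : set (borel_circle R), measurable E -> mu E = nu E.

Definition cintegral (R : realType) (mu : circle_prob R)
    (f : circle R -> R[i]) : R[i] :=
  (\int[mu]_z complex.Re (f z)) +i* (\int[mu]_z complex.Im (f z)).

Definition moment (R : realType) (mu : circle_prob R) (n : nat) : R[i] :=
  cintegral mu (fun z => cval z ^+ n).

(* The quotient is a complex number with zero imaginary part. *)
Definition poisson_kernel (R : realType) (alpha : R[i]) (z : circle R) : R :=
  complex.Re ((1 - `|alpha| ^+ 2) / `|cval z - alpha| ^+ 2).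

Definition generated_subalg (K : comNzRingType) (A : algType K) (X : A) :
    set A :=
  [set a | forall S : {pred A}, GRing.subalg_closed S -> X \in S -> a \in S].

(* [eps j] tells which of the two subalgebras contains the [j]-th factor. *)
Definition cfree (K : comNzRingType) (A : algType K) (phi psi : {scalar A})
    (X Y : A) :=
  forall (n : nat) (eps : nat -> bool) (a : nat -> A),
  (0 < n)%N ->
  (forall j, (j < n)%N -> generated_subalg (if eps j then X else Y) (a j)) ->
  (forall j, (j.+1 < n)%N -> eps j != eps j.+1) ->
  (forall j, (j < n)%N -> psi (a j) = 0) ->
  psi (\prod_(j < n) a j) = 0 /\
  phi (\prod_(j < n) a j) = \prod_(j < n) phi (a j).

Definition has_distribution (R : realType) (A : algType R[i])
    (phi psi : {scalar A}) (X : A) (p : circle_prob R * circle_prob R) :=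
  forall n, (0 < n)%N ->
    phi (X ^+ n) = moment p.1 n /\ psi (X ^+ n) = moment p.2 n.

(* The convolution of [p] and [q], as a relation: [r] is the distribution of
   [X * Y] for some c-free [X], [Y] with distributions [p], [q].  Such [X], [Y]
   always exist, and the moments of [X * Y] do not depend on their choice. *)
Definition cfree_conv (R : realType)
    (p q r : circle_prob R * circle_prob R) : Prop :=
  exists (A : algType R[i]) (phi psi : {scalar A}) (X Y : A),
    [/\ phi 1 = 1, psi 1 = 1, cfree phi psi X Y,
        has_distribution phi psi X p /\ has_distribution phi psi Y q &
        has_distribution phi psi (X * Y) r].

(* [cfree_power p n q] says that [q] is the convolution of [n] copies of [p]. *)
Inductive cfree_power (R : realType) (p : circle_prob R * circle_prob R) :
    nat -> circle_prob R * circle_prob R -> Prop :=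
  | cfree_power1 (q : circle_prob R * circle_prob R) :
      measure_eq p.1 q.1 -> measure_eq p.2 q.2 -> cfree_power p 1 q
  | cfree_powerS n r q :
      cfree_power p n r -> cfree_conv r p q -> cfree_power p n.+1 q.

Definition cfree_infinitely_divisible (R : realType)
    (p : circle_prob R * circle_prob R) : Prop :=
  forall n, (0 < n)%N -> exists pn, cfree_power pn n p.

(* Main.v *)
(* Splitting [(mu, m)] into two factors is enough.  If [X], [Y] are c-free with
   the same distribution and [X * Y] has distribution [(mu, m)], then
   [psi X * psi Y = psi (X * Y)] is the mean of [m], so [psi X = psi Y = 0] and
   c-freeness applies to the alternating products [(X * Y) ^+ k] themselves:
   [mu] has moments [c ^+ k], with [c] the mean of [mu].  Hence [|z - c|^2 dmu]
   has the same moments as [(1 - |c|^2) dm].  In particular [|c| <= 1].  If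
   [|c| = 1], then [mu] lives on [z = c].  If [|c| < 1], the indicator of
   [Re z > a, Im z > b] is a bounded pointwise limit of products of [|z - c|^2]
   with trigonometric polynomials, so [mu] agrees with [P_c dm] on a pi-system
   generating the Borel sets. *)
From HB Require Import structures.
Require Import Defs.
From mathcomp Require Import all_boot all_order all_algebra.
From mathcomp Require Import all_classical all_reals all_analysis.
From mathcomp Require Import measurable_realfun complex ring lra zify.

Set Implicit Arguments.
Unset Strict Implicit.
Unset Printing Implicit Defensive.

Import Order.TTheory GRing.Theory Num.Theory.
Import numFieldNormedType.Exports.

Local Open Scope classical_set_scope.
Local Open Scope complex_scope.
Local Open Scope ring_scope.

(** * Moments of c-free squares *)

Lemma cintegral_measure_eq (R : realType) (mu nu : circle_prob R) f :
  measure_eq mu nu -> cintegral mu f = cintegral nu f.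
Proof.
move=> munu; rewrite /cintegral.
by congr (_ +i* _); congr fine; apply: eq_measure_integral => A mA _;
  exact: munu.
Qed.

(** [cfree_power1] determines its pair only up to equality on Borel sets, so the first factor is a
    pair [r] that agrees with [p] on Borel sets rather than [p] itself. *)
Lemma cfree_power2 (R : realType) (p q : circle_prob R * circle_prob R) :
  cfree_power p 2 q -> exists r : circle_prob R * circle_prob R,
    [/\ measure_eq p.1 r.1, measure_eq p.2 r.2 & cfree_conv r p q].
Proof.
move=> h; inversion h as [|n r ? h1]; subst; exists r; split=> //.
- by inversion h1 as [|? ? ? h2]; subst => //; inversion h2.
- by inversion h1 as [|? ? ? h2]; subst => //; inversion h2.
Qed.

Lemma generated_subalg_id (K : comNzRingType) (A : algType K) (X : A) :
  generated_subalg X X.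
Proof. by []. Qed.

Lemma generated_subalg_subZ1 (K : comNzRingType) (A : algType K) (X : A) k :
  generated_subalg X (X - k%:A).
Proof.
move=> S cS XS; have [S1 SL SM] := cS.
have := SL (- k) 1 X S1 XS.
by rewrite scaleNr addrC.
Qed.

(** C-freeness makes [psi] vanish on the word [(X - psi X)(Y - psi Y)] with centred letters;
    expanding that product gives the formula. *)
Lemma cfree_mean_mul (K : comNzRingType) (A : algType K)
    (phi psi : {scalar A}) (X Y : A) :
  psi 1 = 1 -> cfree phi psi X Y -> psi (X * Y) = psi X * psi Y.
Proof.
move=> psi1 XY.
pose eps j := j == 0%N.
pose a j := if eps j then X - (psi X)%:A else Y - (psi Y)%:A.
have [|||] := XY 2%N eps a isT.
- by move=> j _; rewrite /a; case: ifP => _; exact: generated_subalg_subZ1.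
- by case.
- move=> j _; rewrite /a.
  by case: ifP => _; rewrite linearB linearZ /= psi1 mulr1 subrr.
rewrite !big_ord_recl big_ord0 mulr1 /a/= => + _.
rewrite mulrBl !mulrBr -!scalerAl -!scalerAr !mul1r mulr1.
rewrite !linearB/= !linearZ/= psi1 !mulr1 [psi Y * psi X]mulrC subrr subr0.
by move/eqP; rewrite subr_eq0 => /eqP.
Qed.

(** The letters [X] and [Y] are already centred for [psi], so [(X * Y) ^+ k] is itself an
    alternating word of length [2k] to which c-freeness applies. *)
Lemma cfree_centered_moments (K : comNzRingType) (A : algType K)
    (phi psi : {scalar A}) (X Y : A) k :
  cfree phi psi X Y -> psi X = 0 -> psi Y = 0 -> (0 < k)%N ->
  psi ((X * Y) ^+ k) = 0 /\ phi ((X * Y) ^+ k) = (phi X * phi Y) ^+ k.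
Proof.
move=> XY X0 Y0 k0.
pose a j := if ~~ odd j then X else Y.
(* Stated for any ring, because it serves twice: in [A] for the word and in [K] for the product of
   the values of [phi]. *)
have prodE (B : pzRingType) (u v : B) n :
    \prod_(j < n.*2) (if ~~ odd j then u else v) = (u * v) ^+ n.
  elim: n => [|n IHn]; first by rewrite big_ord0.
  by rewrite doubleS 2!big_ord_recr /= IHn odd_double /= -mulrA exprSr.
have [||||] := XY k.*2 (fun j => ~~ odd j) a.
- by rewrite double_gt0.
- by move=> j _; exact: generated_subalg_id.
- by move=> j _ /=; case: odd.
- by move=> j _; rewrite /a; case: ifP.
have -> : \prod_(j < k.*2) phi (a j) = (phi X * phi Y) ^+ k.
  by rewrite -prodE; apply: eq_bigr => j _; rewrite /a; case: ifP.
by rewrite prodE.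
Qed.

Lemma infinitely_divisible_moments (R : realType)
    (mu nu : circle_prob R) k : cintegral nu (@cval R) = 0 ->
  cfree_infinitely_divisible (mu, nu) -> (0 < k)%N ->
  moment nu k = 0 /\ moment mu k = cintegral mu (@cval R) ^+ k.
Proof.
move=> nu0 /(_ 2%N isT)[p /cfree_power2[r [pr1 pr2]]].
move=> [A [phi [psi [X [Y [phi1 psi1 XY [dX dY] dXY]]]]]] k0.
have [phiXY psiXY] := dXY 1%N isT.
have [phiX psiX] := dX 1%N isT; have [phiY psiY] := dY 1%N isT.
(* Both sides are first moments, of [r.2] and of [p.2], and these measures agree on Borel sets. *)
have psiE : psi X = psi Y.
  by rewrite -(expr1 X) -(expr1 Y) psiX psiY; apply/esym/cintegral_measure_eq.
have psi0 : psi Y = 0.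
  move: psiXY; rewrite expr1 (cfree_mean_mul psi1 XY) psiE => h.
  by apply/eqP; rewrite -sqrf_eq0 expr2 h /moment/= nu0.
have [<- <-] := dXY k k0.
have psi0X : psi X = 0 by rewrite psiE.
have [-> ->] := cfree_centered_moments XY psi0X psi0 k0.
(* The case [k = 1] identifies [phi X * phi Y] with the mean of [mu]. *)
split=> //; congr (_ ^+ _); rewrite -[RHS]/(moment mu 1) -phiXY.
by have [_ ->] := cfree_centered_moments (k := 1) XY psi0X psi0 isT.
Qed.

(** * Quadrants generate the Borel sets of the circle *)

Lemma ge_normRe (R : rcfType) (z : R[i]) : `|complex.Re z|%:C <= `|z|.
Proof. by rewrite normc_def lecR -sqrtr_sqr ler_wsqrtr// lerDl sqr_ge0. Qed.

Lemma ge_normIm (R : rcfType) (z : R[i]) : `|complex.Im z|%:C <= `|z|.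
Proof. by rewrite normc_def lecR -sqrtr_sqr ler_wsqrtr// lerDr sqr_ge0. Qed.

Lemma normc_leD_ReIm (R : rcfType) (z : R[i]) :
  `|z| <= (`|complex.Re z| + `|complex.Im z|)%:C.
Proof.
case: z => x y /=.
have -> : x +i* y = x%:C + 0 +i* y.
  by apply/eqP; rewrite eq_complex/= addr0 add0r !eqxx.
by rewrite (le_trans (ler_normD _ _))// !normc_def/= expr0n/= addr0 add0r
  !sqrtr_sqr -rmorphD.
Qed.

(** A contraction is continuous, so preimages of open rays are open. The cast [%:C] is there because
    the norm of [R[i]] takes its values in [R[i]]. *)
Lemma measurable_circle_contracting (R : realType) (f : R[i] -> R) :
  (forall z w, `|f z - f w|%:C <= `|z - w|) ->
  measurable_fun setT (fun z : borel_circle R => f (cval z)).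
Proof.
move=> ctr; apply: (measurability _ (RGenOInfty.measurableE R)) => //.
move=> _ [_ [a ->] <-]; rewrite setTI; apply: sub_sigma_algebra.
exists [set w : R[i] | a < f w] => //=; last first.
  by apply/seteqP; split => z /=; rewrite in_itv/= andbT.
rewrite openE => z /= az; apply/nbhs_ballP.
exists (f z - a)%:C => /=; first by rewrite ltcR subr_gt0.
move=> w; rewrite -ball_normE/= => /(le_lt_trans (ctr _ _)).
rewrite ltcR => /(le_lt_trans (ler_norm _)); lra.
Qed.

Lemma measurable_circle_Re (R : realType) :
  measurable_fun setT (fun z : borel_circle R => complex.Re (cval z)).
Proof.
apply: measurable_circle_contracting => z w.
rewrite (_ : _ - _ = complex.Re (z - w)) ?ge_normRe//.
by case: z w => [? ?] [? ?].
Qed.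

Lemma measurable_circle_Im (R : realType) :
  measurable_fun setT (fun z : borel_circle R => complex.Im (cval z)).
Proof.
apply: measurable_circle_contracting => z w.
rewrite (_ : _ - _ = complex.Im (z - w)) ?ge_normIm//.
by case: z w => [? ?] [? ?].
Qed.

Lemma circle_norm (R : realType) (z : circle R) : `|cval z| = 1.
Proof. by have /set_mem := valP z. Qed.

Definition quadrant {R : realType} (a b : R) : set (borel_circle R) :=
  [set z | a < complex.Re (cval z) /\ b < complex.Im (cval z)].

Definition quadrants (R : realType) : set (set (borel_circle R)) :=
  [set E | exists a b, E = quadrant a b].
Arguments quadrants : clear implicits.

Lemma measurable_quadrant (R : realType) (a b : R) : measurable (quadrant a b).
Proof.
apply: measurableI.
- have := @measurable_circle_Re R measurableT `]a, +oo[%classic.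
  rewrite setTI (_ : _ @^-1` _ = [set z | a < complex.Re (cval z)]); first exact.
  by apply/seteqP; split => z /=; rewrite in_itv/= andbT.
- have := @measurable_circle_Im R measurableT `]b, +oo[%classic.
  rewrite setTI (_ : _ @^-1` _ = [set z | b < complex.Im (cval z)]); first exact.
  by apply/seteqP; split => z /=; rewrite in_itv/= andbT.
Qed.

Lemma circle_Re_norm1 (R : realType) (z : circle R) : `|complex.Re (cval z)| <= 1.
Proof. by have := ge_normRe (cval z); rewrite circle_norm lecR. Qed.

Lemma circle_Im_norm1 (R : realType) (z : circle R) : `|complex.Im (cval z)| <= 1.
Proof. by have := ge_normIm (cval z); rewrite circle_norm lecR. Qed.

Lemma quadrantT (R : realType) : quadrant (-2) (-2) = [set: borel_circle R].
Proof.
apply/seteqP; split => // z _; rewrite /quadrant/=.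
have := circle_Re_norm1 z; have := circle_Im_norm1 z.
rewrite !ler_norml => /andP[? _] /andP[? _]; split; lra.
Qed.

Lemma setI_closed_quadrants (R : realType) : setI_closed (quadrants R).
Proof.
move=> _ _ [a [b ->]] [c [d ->]]; exists (Num.max a c), (Num.max b d).
by apply/seteqP; split => z; rewrite /quadrant/= !gt_max;
  [move=> [[-> ->] [-> ->]]|move=> [/andP[-> ->] /andP[-> ->]]].
Qed.

(** An open set is the countable union of the half-open boxes inside it that have a rational corner
    and side [1 / (n + 1)]; each box comes from half planes by differences and an intersection. *)
Lemma sigma_quadrants (R : realType) :
  @measurable _ (borel_circle R) = <<s quadrants R >>.
Proof.
apply/seteqP; split; last first.
  apply: smallest_sub; first exact: sigma_algebra_measurable.
  by move=> _ [a [b ->]]; exact: measurable_quadrant.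
apply: smallest_sub; first exact: smallest_sigma_algebra.
move=> _ [V oV <-].
pose gT := g_sigma_algebraType (quadrants R).
(* A half plane is a quadrant whose other bound, [-2], lies below every coordinate on the circle. *)
have mx a : measurable ([set z | a < complex.Re (cval z)] : set gT).
  apply: sub_sigma_algebra; exists a, (-2); apply/seteqP; split => z [] //= az.
  have : (quadrant (-2) (-2) : set (borel_circle R)) z by rewrite quadrantT.
  by case.
have my b : measurable ([set z | b < complex.Im (cval z)] : set gT).
  apply: sub_sigma_algebra; exists (-2), b; apply/seteqP; split => z //=; last by case.
  have : (quadrant (-2) (-2) : set (borel_circle R)) z by rewrite quadrantT.
  by case.
pose e (n : nat) : R := n.+1%:R^-1.
pose box (i : rat * rat * nat) : set gT := [set z |
  [/\ ratr i.1.1 < complex.Re (cval z), complex.Re (cval z) <= ratr i.1.1 + e i.2,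
     ratr i.1.2 < complex.Im (cval z) & complex.Im (cval z) <= ratr i.1.2 + e i.2]].
have mbox i : measurable (box i).
  rewrite (_ : box i = ([set z | ratr i.1.1 < complex.Re (cval z)]
    `\` [set z | ratr i.1.1 + e i.2 < complex.Re (cval z)]) `&`
    ([set z | ratr i.1.2 < complex.Im (cval z)]
    `\` [set z | ratr i.1.2 + e i.2 < complex.Im (cval z)])).
    by apply: measurableI; apply: measurableD.
  apply/seteqP; split => z; rewrite /box /=.
    by move=> [? ? ? ?]; do !split => //; apply/negP; rewrite -leNgt.
  by move=> [[? /negP ?] [? /negP ?]]; rewrite !leNgt; split.
pose D i := `[< box i `<=` (val @^-1` V : set (circle R)) >].
(* Boxes that are not inside [V] are replaced by the empty set, so that the union runs over the
   whole countable index type. *)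
pose F i := if D i then box i else set0.
suff -> : (set_val @^-1` V : set (circle R)) = \bigcup_i F i.
  apply: (@countable_bigcupT_measurable _ gT) => // i; rewrite /F.
  by case: ifP => // _; exact: measurable0.
apply/seteqP; split => [z Vz|z [i _]]; last first.
  by rewrite /F; case: ifP => // /asboolP; exact.
have /nbhs_ballP[d /= d0 dV] : nbhs (cval z : (R[i] : numFieldType)) V.
  by move: oV; rewrite openE; apply.
(* Positivity in [R[i]] forces the imaginary part to vanish, so the radius is a real number. *)
have [r r0 dE] : exists2 r : R, 0 < r & d = r%:C.
  case: d d0 {dV} => a b; rewrite ltcE/= => /andP[/eqP b0 a0].
  by exists a => //; rewrite b0.
(* The norm is at most the sum of the moduli of the two coordinates, so a side below [r / 2] keeps
   the box inside the ball of radius [r]. *)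
have [n rn] : exists n, e n < r / 2.
  have /ltr_add_invr[n] : 0 < r / 2 by rewrite divr_gt0.
  by rewrite add0r; exists n.
have e0 : 0 < e n by rewrite invr_gt0.
have [p /[!in_itv]/= /andP[p1 p2]] : exists p : rat,
    ratr p \in `]complex.Re (cval z) - e n, complex.Re (cval z)[.
  by apply: rat_in_itvoo; rewrite ltrBlDr ltrDl.
have [q /[!in_itv]/= /andP[q1 q2]] : exists q : rat,
    ratr q \in `]complex.Im (cval z) - e n, complex.Im (cval z)[.
  by apply: rat_in_itvoo; rewrite ltrBlDr ltrDl.
exists (p, q, n) => //; rewrite /F ifT; first by split=> //=; lra.
apply/asboolP => w [/= w1 w2 w3 w4]; apply: dV.
rewrite -ball_normE/= dE (le_lt_trans (normc_leD_ReIm _))// ltcR.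
have -> : complex.Re (cval z - cval w) = complex.Re (cval z) - complex.Re (cval w).
  by case: (cval z) (cval w) => [? ?] [? ?].
have -> : complex.Im (cval z - cval w) = complex.Im (cval z) - complex.Im (cval w).
  by case: (cval z) (cval w) => [? ?] [? ?].
have : `|complex.Re (cval z) - complex.Re (cval w)| < r / 2.
  by rewrite ltr_norml; apply/andP; split; lra.
have : `|complex.Im (cval z) - complex.Im (cval w)| < r / 2.
  by rewrite ltr_norml; apply/andP; split; lra.
lra.
Qed.

(** * Polynomial approximation of a step *)

Lemma bernoulli_inequality (R : realDomainType) (x : R) n :
  -1 <= x -> 1 + x *+ n <= (1 + x) ^+ n.
Proof.
move=> x1; elim: n => [|n IHn]; first by rewrite mulr0n addr0 expr0.
rewrite exprS (@le_trans _ _ ((1 + x) * (1 + x *+ n)))//; last first.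
  by rewrite ler_wpM2l// -lerBlDl sub0r.
rewrite mulrDl mul1r mulrDr mulr1 mulrS mulrnAr -expr2.
have : 0 <= x ^+ 2 *+ n by rewrite mulrn_wge0// sqr_ge0.
lra.
Qed.

(** Write [s = u^2] and [1/u = 1 + d]. Bernoulli's inequality bounds [n u^n] by [1/d], and the
    remaining factor [u^n] tends to zero. *)
Lemma cvg_natr_geometric (R : realType) (s : R) : 0 <= s < 1 ->
  n%:R * s ^+ n @[n --> \oo] --> 0.
Proof.
move=> /andP[]; rewrite le_eqVlt => /predU1P[<- _|s0 s1].
  rewrite (_ : (fun n => _) = cst 0); first exact: cvg_cst.
  by apply/funext => -[|n]; rewrite ?mul0r// expr0n mulr0.
pose u := Num.sqrt s.
have u0 : 0 < u by rewrite sqrtr_gt0.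
have u1 : u < 1 by rewrite -sqrtr1 ltr_sqrt.
have sE : s = u ^+ 2 by rewrite sqr_sqrtr// ltW.
pose d := u^-1 - 1.
have d0 : 0 < d by rewrite subr_gt0 invf_gt1.
have nu n : n%:R * u ^+ n <= d^-1.
  have : 1 + d *+ n <= (1 + d) ^+ n.
    by apply: bernoulli_inequality; rewrite (le_trans _ (ltW d0)).
  rewrite [1 + d]addrC subrK exprVn => h.
  rewrite -ler_pdivlMr ?exprn_gt0// (@le_trans _ _ (d^-1 * (d *+ n)))//.
    by rewrite -[d *+ n]mulr_natr mulKf// gt_eqF.
  rewrite ler_pM2l ?invr_gt0// (le_trans _ h)//; lra.
have h0 : d^-1 * u ^+ n @[n --> \oo] --> 0.
  by apply: cvg_geometric; rewrite ger0_norm// ltW.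
apply: (squeeze_cvgr _ (cvg_cst 0) h0); apply: nearW => n.
rewrite sE -exprM mulnC exprM expr2 mulrA.
have un0 : 0 <= u ^+ n by rewrite exprn_ge0// ltW.
by rewrite !mulr_ge0 ?ler0n//= ler_wpM2r.
Qed.

(** Polynomials of this shape occur in elementary proofs of the Weierstrass approximation theorem:
    on [[0, 1]] they tend to the indicator of [t < 1/2]. *)
Definition step_poly {R : realType} (n : nat) (t : R) : R :=
  (1 - t ^+ n) ^+ (n * 2 ^ n).

Lemma step_poly_itv (R : realType) n (t : R) : 0 <= t <= 1 ->
  0 <= step_poly n t <= 1.
Proof.
move=> /andP[t0 t1]; have tn0 : 0 <= t ^+ n by rewrite exprn_ge0.
have tn1 : t ^+ n <= 1 by rewrite exprn_ile1.
by rewrite exprn_ge0 ?exprn_ile1//; lra.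
Qed.

(* The factor [n] in the exponent makes the limit vanish at [t = 1/2] too. *)
Lemma cvg_step_poly (R : realType) (t : R) : 0 <= t <= 1 ->
  step_poly n t @[n --> \oo] --> ((t < 2^-1)%R%:R : R).
Proof.
move=> t01; have /andP[t0 t1] := t01; have [th|th] := ltP t 2^-1.
  have s01 : 0 <= 2 * t < 1 by apply/andP; split; lra.
  (* By Bernoulli's inequality this sequence is a lower bound for [step_poly n t]. *)
  have h1 : 1 - n%:R * (2 * t) ^+ n @[n --> \oo] --> (1 : R).
    rewrite -[X in _ --> X]subr0.
    by apply: cvgB; [exact: cvg_cst|exact: cvg_natr_geometric].
  rewrite -[X in _ --> X]/(1 : R).
  apply: (squeeze_cvgr _ h1 (cvg_cst (1 : R))); apply: nearW => n.
  have /andP[_ ->] := step_poly_itv n t01; rewrite andbT.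
  have : 1 + - t ^+ n *+ (n * 2 ^ n) <= step_poly n t.
    by apply: bernoulli_inequality; rewrite lerN2 exprn_ile1.
  by rewrite mulNrn -[t ^+ n *+ _]mulr_natl natrM natrX -mulrA exprMn.
rewrite -[X in _ --> X]/(0 : R).
apply: (squeeze_cvgr _ (cvg_cst (0 : R)) (@cvg_harmonic R)); apply: nearW => n.
have /andP[-> _] /= := step_poly_itv n t01.
have tn0 : 0 <= t ^+ n by rewrite exprn_ge0.
have tn1 : t ^+ n <= 1 by rewrite exprn_ile1.
set m := (n * 2 ^ n)%N.
(* Bernoulli's inequality gives [(1 + t^n)^m >= 1 + n (2t)^n], which is at least [n + 1] since
   [2t >= 1]. Times [step_poly n t] it becomes [(1 - t^(2n))^m <= 1], whence the bound
   [1 / (n + 1)]. *)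
have h1 : n.+1%:R <= (1 + t ^+ n) ^+ m.
  rewrite (@le_trans _ _ (1 + t ^+ n *+ m))//; last first.
    by apply: bernoulli_inequality; rewrite (le_trans _ tn0).
  rewrite -natr1 addrC lerD2l -[t ^+ n *+ _]mulr_natl natrM natrX -mulrA -exprMn.
  rewrite ler_peMr ?ler0n// exprn_ege1//; lra.
have h2 : step_poly n t * (1 + t ^+ n) ^+ m <= 1.
  rewrite /step_poly -exprMn exprn_ile1//; nra.
rewrite -[leRHS]mul1r ler_pdivlMr ?ltr0Sn// (le_trans _ h2)//.
by rewrite ler_wpM2l//; case/andP: (step_poly_itv n t01).
Qed.

(** * Bounded measurable functions and bounded convergence *)

Definition bounded_measurable d (T : measurableType d) (R : realType)
    (f : T -> R) :=
  measurable_fun setT f /\ exists M, forall x, `|f x| <= M.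

Lemma bounded_measurable_cst d (T : measurableType d) (R : realType) (k : R) :
  bounded_measurable (fun _ : T => k).
Proof. by split; [exact: measurable_cst|exists `|k|]. Qed.

Lemma bounded_measurableD d (T : measurableType d) (R : realType)
    (f g : T -> R) : bounded_measurable f -> bounded_measurable g ->
  bounded_measurable (fun x => f x + g x).
Proof.
move=> [mf [M fM]] [mg [N gN]]; split; first exact: measurable_funD.
by exists (M + N) => x; rewrite (le_trans (ler_normD _ _))// lerD.
Qed.

Lemma bounded_measurableM d (T : measurableType d) (R : realType)
    (f g : T -> R) : bounded_measurable f -> bounded_measurable g ->
  bounded_measurable (fun x => f x * g x).
Proof.
move=> [mf [M fM]] [mg [N gN]]; split; first exact: measurable_funM.
by exists (M * N) => x; rewrite normrM ler_pM.
Qed.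

Lemma bounded_measurableN d (T : measurableType d) (R : realType)
    (f : T -> R) : bounded_measurable f -> bounded_measurable (fun x => - f x).
Proof.
move=> [mf [M fM]]; split; first exact: measurableT_comp.
by exists M => x; rewrite normrN.
Qed.

Lemma bounded_measurable_integrable d (T : measurableType d) (R : realType)
    (mu : probability T R) (f : T -> R) :
  bounded_measurable f -> mu.-integrable setT (EFin \o f).
Proof.
move=> [mf [M fM]]; apply: measurable_bounded_integrable => //.
  by rewrite [ltLHS]probability_setT ltry.
exists M; split; first by rewrite num_real.
by move=> N MN x _; exact: le_trans (fM x) (ltW MN).
Qed.

(** Dominated convergence with a constant bound, which is integrable because the measure is
    finite. *)
Lemma bounded_cvg_Rintegral d (T : measurableType d) (R : realType)
    (mu : probability T R) (f_ : nat -> T -> R) (f : T -> R) (K : R) :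
  (forall n, measurable_fun setT (f_ n)) -> measurable_fun setT f ->
  (forall n x, `|f_ n x| <= K) -> (forall x, f_ n x @[n --> \oo] --> f x) ->
  \int[mu]_x f_ n x @[n --> \oo] --> \int[mu]_x f x.
Proof.
move=> mf_ mf fK cvf.
have iK : mu.-integrable setT (EFin \o cst K).
  exact/bounded_measurable_integrable/bounded_measurable_cst.
have [||||iF _ cv] := @dominated_convergence _ _ _ mu setT measurableT
  (fun n => EFin \o f_ n) (EFin \o f) (EFin \o cst K) _ _ _ iK.
- by move=> n; exact/measurable_EFinP.
- exact/measurable_EFinP.
- by apply: aeW => x _; apply/fine_cvgP; split; [exact: nearW|exact: cvf].
- by apply: aeW => x n _; rewrite lee_fin.
by apply: fine_cvg; rewrite fineK//; exact: integrable_fin_num.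
Qed.

(** * Trigonometric polynomials *)

Lemma ReD (R : rcfType) (z w : R[i]) :
  complex.Re (z + w) = complex.Re z + complex.Re w.
Proof. by case: z w => [? ?] [? ?]. Qed.

Lemma ImD (R : rcfType) (z w : R[i]) :
  complex.Im (z + w) = complex.Im z + complex.Im w.
Proof. by case: z w => [? ?] [? ?]. Qed.

Lemma ReM (R : rcfType) (z w : R[i]) : complex.Re (z * w) =
  complex.Re z * complex.Re w - complex.Im z * complex.Im w.
Proof. by case: z w => [? ?] [? ?]. Qed.

Lemma ImM (R : rcfType) (z w : R[i]) : complex.Im (z * w) =
  complex.Re z * complex.Im w + complex.Im z * complex.Re w.
Proof. by case: z w => [? ?] [? ?]. Qed.

Definition cbounded_measurable (R : realType) (f : circle R -> R[i]) :=
  bounded_measurable (fun z : borel_circle R => complex.Re (f z)) /\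
  bounded_measurable (fun z : borel_circle R => complex.Im (f z)).

Lemma cbounded_measurable_cst (R : realType) (k : R[i]) :
  cbounded_measurable (fun _ : circle R => k).
Proof. by split; exact: bounded_measurable_cst. Qed.

Lemma cbounded_measurable_real (R : realType) (f : borel_circle R -> R) :
  bounded_measurable f -> cbounded_measurable (fun z => (f z)%:C).
Proof. by move=> bf; split=> //=; exact: bounded_measurable_cst. Qed.

Lemma cbounded_measurableD (R : realType) (f g : circle R -> R[i]) :
  cbounded_measurable f -> cbounded_measurable g ->
  cbounded_measurable (fun z => f z + g z).
Proof.
move=> [rf imf] [rg ig]; split.
- by under eq_fun do rewrite ReD; exact: bounded_measurableD.
- by under eq_fun do rewrite ImD; exact: bounded_measurableD.
Qed.

Lemma cbounded_measurableM (R : realType) (f g : circle R -> R[i]) :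
  cbounded_measurable f -> cbounded_measurable g ->
  cbounded_measurable (fun z => f z * g z).
Proof.
move=> [rf imf] [rg ig]; split.
- under eq_fun do rewrite ReM; apply: bounded_measurableD.
    exact: bounded_measurableM.
  exact/bounded_measurableN/bounded_measurableM.
- by under eq_fun do rewrite ImM; apply: bounded_measurableD;
    exact: bounded_measurableM.
Qed.

Lemma cbounded_measurableX (R : realType) (f : circle R -> R[i]) n :
  cbounded_measurable f -> cbounded_measurable (fun z => f z ^+ n).
Proof.
move=> bf; elim: n => [|n IHn].
  by under eq_fun do rewrite expr0; exact: cbounded_measurable_cst.
by under eq_fun do rewrite exprS; exact: cbounded_measurableM.
Qed.

Lemma cbounded_measurable_conjc (R : realType) (f : circle R -> R[i]) :
  cbounded_measurable f -> cbounded_measurable (fun z => (f z)^*).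
Proof.
move=> [rf imf]; split.
- rewrite (_ : (fun z => _) = fun z => complex.Re (f z))//.
  by apply/funext => z; case: (f z).
- rewrite (_ : (fun z => _) = fun z => - complex.Im (f z)).
    exact: bounded_measurableN.
  by apply/funext => z; case: (f z).
Qed.

Lemma bounded_measurable_circle_Re (R : realType) :
  bounded_measurable (fun z : borel_circle R => complex.Re (cval z)).
Proof.
by split; [exact: measurable_circle_Re|exists 1; exact: circle_Re_norm1].
Qed.

Lemma bounded_measurable_circle_Im (R : realType) :
  bounded_measurable (fun z : borel_circle R => complex.Im (cval z)).
Proof.
by split; [exact: measurable_circle_Im|exists 1; exact: circle_Im_norm1].
Qed.

Lemma cbounded_measurable_cval (R : realType) : cbounded_measurable (@cval R).
Proof.
by split; [exact: bounded_measurable_circle_Re|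
           exact: bounded_measurable_circle_Im].
Qed.

Lemma cintegralD (R : realType) (mu : circle_prob R) (f g : circle R -> R[i]) :
  cbounded_measurable f -> cbounded_measurable g ->
  cintegral mu (fun z => f z + g z) = cintegral mu f + cintegral mu g.
Proof.
move=> [rf imf] [rg ig]; rewrite /cintegral.
under eq_Rintegral do rewrite ReD.
rewrite RintegralD//; [|exact: bounded_measurable_integrable..].
under [X in _ +i* X = _]eq_Rintegral do rewrite ImD.
by rewrite RintegralD//; exact: bounded_measurable_integrable.
Qed.

Lemma cintegralZ (R : realType) (mu : circle_prob R) k (f : circle R -> R[i]) :
  cbounded_measurable f ->
  cintegral mu (fun z => k * f z) = k * cintegral mu f.
Proof.
move=> [rf imf]; rewrite /cintegral; case: k => a b.
have bZ c (h : borel_circle R -> R) : bounded_measurable h ->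
    mu.-integrable setT (EFin \o (fun z => c * h z)).
  move=> bh; apply: bounded_measurable_integrable.
  by apply: bounded_measurableM => //; exact: bounded_measurable_cst.
under eq_Rintegral do rewrite ReM.
rewrite RintegralB//; [|exact: bZ..].
under [X in _ +i* X = _]eq_Rintegral do rewrite ImM.
rewrite RintegralD//; [|exact: bZ..].
by rewrite !RintegralZl//; exact: bounded_measurable_integrable.
Qed.

(** The two claims are proved together: additivity of the integral in the induction step requires
    the partial sum to be bounded and measurable. *)
Lemma cintegral_sum (R : realType) (mu : circle_prob R) n (k : nat -> R[i])
    (f : nat -> circle R -> R[i]) :
  (forall j, cbounded_measurable (f j)) ->
  cbounded_measurable (fun z => \sum_(j < n) k j * f j z) /\
  cintegral mu (fun z => \sum_(j < n) k j * f j z) =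
    \sum_(j < n) k j * cintegral mu (f j).
Proof.
move=> bf; elim: n => [|n [IHb IHn]].
  rewrite big_ord0; under eq_fun do rewrite big_ord0.
  split; first exact: cbounded_measurable_cst.
  by rewrite /cintegral !Rintegral_cst// !mul0r.
have bkf : cbounded_measurable (fun z => k n * f n z).
  by apply: cbounded_measurableM => //; exact: cbounded_measurable_cst.
have -> : (fun z => \sum_(j < n.+1) k j * f j z) =
    (fun z => \sum_(j < n) k j * f j z + k n * f n z).
  by apply/funext => z; rewrite big_ord_recr.
split; first exact: cbounded_measurableD.
by rewrite cintegralD// IHn cintegralZ// big_ord_recr.
Qed.

Lemma cintegral_conjc (R : realType) (mu : circle_prob R)
    (f : circle R -> R[i]) : cbounded_measurable f ->
  cintegral mu (fun z => (f z)^*) = (cintegral mu f)^*.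
Proof.
move=> [_ imf]; rewrite /cintegral /=; congr (_ +i* _).
  by apply: eq_Rintegral => z _; case: (f z).
rewrite -mulN1r -RintegralZl//; last exact: bounded_measurable_integrable.
by apply: eq_Rintegral => z _; rewrite mulN1r; case: (f z).
Qed.

Lemma cintegral_real (R : realType) (mu : circle_prob R) (f : circle R -> R) :
  cintegral mu (fun z => (f z)%:C) = (\int[mu]_z f z)%:C.
Proof. by rewrite /cintegral /= Rintegral_cst// mul0r. Qed.

Lemma circle_mulJ (R : realType) (z : circle R) : cval z * (cval z)^* = 1.
Proof. by rewrite -sqr_normc circle_norm expr1n. Qed.

(** On the circle this is the integer power [z^(k - l)]; two natural exponents stand in for a signed
    one. *)
Definition circle_monomial {R : realType} (k l : nat) (z : circle R) : R[i] :=
  cval z ^+ k * (cval z)^* ^+ l.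

Lemma cbounded_measurable_monomial (R : realType) k l :
  cbounded_measurable (@circle_monomial R k l).
Proof.
apply: cbounded_measurableM; apply: cbounded_measurableX.
  exact: cbounded_measurable_cval.
exact/cbounded_measurable_conjc/cbounded_measurable_cval.
Qed.

(** Subtraction is truncated, so at least one of the two exponents on the right is zero and the
    formula covers both signs. Negative powers integrate to conjugates of moments. *)
Lemma cintegral_monomial (R : realType) (mu : circle_prob R) c k l :
  (forall n, (0 < n)%N -> moment mu n = c ^+ n) ->
  cintegral mu (circle_monomial k l) = c ^+ (k - l) * c^* ^+ (l - k).
Proof.
move=> muc; have muE n : moment mu n = c ^+ n.
  case: n => [|n]; last exact: muc.
  have -> : moment mu 0 = cintegral mu (fun z => (1 : R)%:C).
    by congr cintegral; apply/funext => z; rewrite expr0.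
  by rewrite cintegral_real Rintegral_cst// mul1r
    [X in (fine X)%:C]probability_setT.
have [lk|kl] := leqP l k.
  rewrite (eqP (_ : l - k == 0)%N) ?subn_eq0// expr0 mulr1 -muE.
  congr cintegral; apply/funext => z; rewrite /circle_monomial.
  by rewrite -{1}(subnK lk) exprD -mulrA -exprMn circle_mulJ expr1n mulr1.
rewrite (eqP (_ : k - l == 0)%N) ?subn_eq0 1?ltnW// expr0 mul1r.
rewrite -rmorphXn/= -muE -cintegral_conjc; last first.
  exact/cbounded_measurableX/cbounded_measurable_cval.
congr cintegral; apply/funext => z; rewrite /circle_monomial rmorphXn/=.
by rewrite -{1}(subnKC (ltnW kl)) exprD mulrA -exprMn circle_mulJ expr1n mul1r.
Qed.

(** A real-valued Laurent polynomial on the circle: a polynomial in [z] over the common denominator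
    [z^l], with [1/z] written as the conjugate. *)
Definition trig_poly {R : realType} (f : circle R -> R) :=
  exists (p : {poly R[i]}) l, forall z, (f z)%:C = p.[cval z] * (cval z)^* ^+ l.

Lemma trig_poly_cst (R : realType) (k : R) : trig_poly (fun=> k).
Proof. by exists k%:C%:P, 0%N => z; rewrite hornerC expr0 mulr1. Qed.

Lemma trig_polyD (R : realType) (f g : circle R -> R) :
  trig_poly f -> trig_poly g -> trig_poly (fun z => f z + g z).
Proof.
(* The sum over the common denominator [z^(k + l)]. *)
move=> [p [k fp]] [q [l gq]]; exists (p * 'X^l + q * 'X^k), (k + l)%N => z.
rewrite rmorphD/= fp gq !hornerE.
have h n : cval z ^+ n * (cval z)^* ^+ n = 1.
  by rewrite -exprMn circle_mulJ expr1n.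
rewrite mulrDl exprD; congr (_ + _).
  by rewrite mulrACA h mulr1.
by rewrite [X in _ * _ * X]mulrC mulrACA h mulr1.
Qed.

Lemma trig_polyM (R : realType) (f g : circle R -> R) :
  trig_poly f -> trig_poly g -> trig_poly (fun z => f z * g z).
Proof.
move=> [p [k fp]] [q [l gq]]; exists (p * q), (k + l)%N => z.
by rewrite rmorphM/= fp gq hornerM exprD mulrACA.
Qed.

Lemma trig_polyB (R : realType) (f g : circle R -> R) :
  trig_poly f -> trig_poly g -> trig_poly (fun z => f z - g z).
Proof.
move=> tf tg; under eq_fun do rewrite -mulN1r.
by apply: trig_polyD => //; apply: trig_polyM => //; exact: trig_poly_cst.
Qed.

Lemma trig_polyX (R : realType) (f : circle R -> R) n :
  trig_poly f -> trig_poly (fun z => f z ^+ n).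
Proof.
move=> tf; elim: n => [|n IHn].
  by under eq_fun do rewrite expr0; exact: trig_poly_cst.
by under eq_fun do rewrite exprS; exact: trig_polyM.
Qed.

Lemma trig_poly_Re (R : realType) :
  trig_poly (fun z : circle R => complex.Re (cval z)).
Proof.
(* On the circle, [Re z = (z + 1/z) / 2 = (z^2 + 1) / (2 z)]. *)
exists (2^-1 *: ('X^2 + 1)), 1%N => z.
rewrite ReJ_add !hornerE expr1 mulrC.
have h := circle_mulJ z; set v := cval z in h *; set w := conjc v in h *.
transitivity (2^-1 * (v * (v * w) + w)); first by rewrite h mulr1.
by ring.
Qed.

Lemma trig_poly_Im (R : realType) :
  trig_poly (fun z : circle R => complex.Im (cval z)).
Proof.
(* On the circle, [Im z = (z - 1/z) / (2 i) = (i / 2) (1 - z^2) / z]. *)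
exists (('i / 2) *: (1 - 'X^2)), 1%N => z.
rewrite ImJ_sub !hornerE expr1.
have h := circle_mulJ z; set v := cval z in h *; set w := conjc v in h *.
transitivity ((w - v * (v * w)) / 2 * 'i); first by rewrite h mulr1.
by ring.
Qed.

Lemma trig_poly_bounded_measurable (R : realType) (f : borel_circle R -> R) :
  trig_poly f -> bounded_measurable f.
Proof.
move=> [p [l fp]].
suff [] : cbounded_measurable (fun z => (f z)%:C) by [].
under eq_fun do rewrite fp horner_coef.
apply: cbounded_measurableM; last first.
  exact/cbounded_measurableX/cbounded_measurable_conjc/cbounded_measurable_cval.
(* The boundedness half of [cintegral_sum] is what is wanted here; [haar R] only instantiates its
   measure argument. *)
have [|//] := @cintegral_sum R (haar R) (size p) (fun j => p`_j)
  (fun j z => cval z ^+ j).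
by move=> j; exact/cbounded_measurableX/cbounded_measurable_cval.
Qed.

(** Both sides are linear in [f], so an identity between integrals of monomials extends to real
    trigonometric polynomials, after a passage through complex integrals. *)
Lemma trig_poly_Rintegral (R : realType) (mu nu : circle_prob R)
    (g : borel_circle R -> R) (C : R) (f : circle R -> R) :
  bounded_measurable g ->
  (forall k l, cintegral mu (fun z => (g z)%:C * circle_monomial k l z) =
    C%:C * cintegral nu (circle_monomial k l)) ->
  trig_poly f -> \int[mu]_z (f z * g z) = C * \int[nu]_z f z.
Proof.
move=> bg gmu [p [l fp]]; apply: (@complexI R).
rewrite rmorphM/= -!cintegral_real.
have fE z : (f z)%:C = \sum_(j < size p) p`_j * circle_monomial j l z.
  rewrite fp horner_coef mulr_suml; apply: eq_bigr => j _.
  by rewrite mulrA.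
rewrite [X in cintegral nu X](funext fE).
rewrite (@cintegral_sum R nu _ _ _ (fun j => @cbounded_measurable_monomial R j l)).2.
rewrite (_ : (fun z => _) = fun z => \sum_(j < size p)
    p`_j * ((g z)%:C * circle_monomial j l z)); last first.
  apply/funext => z; rewrite rmorphM/= fE mulr_suml.
  by apply: eq_bigr => j _; rewrite mulrAC -mulrA.
have bgm j : cbounded_measurable (fun z => (g z)%:C * circle_monomial j l z).
  apply: cbounded_measurableM; last exact: cbounded_measurable_monomial.
  exact: cbounded_measurable_real.
rewrite (@cintegral_sum R mu _ _ _ bgm).2 mulr_sumr; apply: eq_bigr => j _.
by rewrite gmu mulrCA.
Qed.

(** * Arc length has mean zero *)

(** The integral is transported to [[0, 2 pi]] and evaluated by the fundamental theorem of calculus.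
    It is carried out for [1 + h], with primitive [t + F t], since the change of variables applies
    to nonnegative integrands. *)
Lemma Rintegral_haar_primitive (R : realType) (h : borel_circle R -> R)
    (f F : R -> R) :
  measurable_fun setT h -> (forall z, `|h z| <= 1) ->
  (forall t, h (expi t) = f t) -> continuous f ->
  (forall t : R, is_derive t 1 F (f t)) -> F (2 * pi) = F 0 ->
  \int[haar R]_z h z = 0.
Proof.
move=> mh h1 hf cf dF F0.
have bh : bounded_measurable h by split=> //; exists 1.
have h0 z : 0 <= 1 + h z by have := h1 z; rewrite ler_norml => /andP[]; lra.
have mh1 : measurable_fun setT (fun z => (1 + h z)%:E).
  by apply/measurable_EFinP; exact: measurable_funD.
have cf1 : continuous (fun t => 1 + f t).
  by move=> t; apply: cvgD; [exact: cvg_cst|exact: cf].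
have dG (t : R) : is_derive t 1 (id \+ F) (1 + f t) by exact: is_deriveD.
have pi2 := two_pi_gt0 R.
have : (\int[haar R]_z (1 + h z)%:E = 1)%E.
  rewrite ge0_integral_distribution//.
  rewrite integral_uniform//=; last 2 first.
    by apply: measurableT_comp mh1 _; exact: measurable_borel_expi.
    by move=> t; rewrite lee_fin.
  under eq_integral do rewrite /borel_expi hf.
  rewrite (@continuous_FTC2 _ _ (id \+ F))//.
  - by rewrite /= F0 add0r -EFinB -EFinM subr0 addrK mulVf ?gt_eqF.
  - exact: continuous_subspaceT.
  - have cG : continuous (id \+ F).
      by move=> t; apply/differentiable_continuous/derivable1_diffP; case: (dG t).
    split.
    + by move=> t _; case: (dG t).
    + by apply: cvg_at_right_filter; exact: cG.
    + by apply: cvg_at_left_filter; exact: cG.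
  - by move=> t _; rewrite derive1E; case: (dG t).
move=> /(congr1 fine); rewrite -[LHS]/(\int[haar R]_z (1 + h z)).
rewrite RintegralD//; [|exact/bounded_measurable_integrable/
  bounded_measurable_cst|exact: bounded_measurable_integrable].
rewrite Rintegral_cst// [X in fine X]probability_setT mul1r /=; lra.
Qed.

Lemma cintegral_haar_cval (R : realType) : cintegral (haar R) (@cval R) = 0.
Proof.
have dcos (t : R) : is_derive t 1 (fun t => - cos t) (sin t).
  by rewrite -[X in is_derive _ _ _ X]opprK; exact: is_deriveN.
rewrite /cintegral.
rewrite (Rintegral_haar_primitive (@measurable_circle_Re R)
  (@circle_Re_norm1 R) (fun=> erefl) (@continuous_cos R)
  (fun t => is_derive_sin t)); last by rewrite mulr_natl sin2pi sin0.
rewrite (Rintegral_haar_primitive (@measurable_circle_Im R)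
  (@circle_Im_norm1 R) (fun=> erefl) (@continuous_sin R) dcos)//.
by rewrite mulr_natl cos2pi cos0.
Qed.

(** * The weight |z - c|^2 *)

(** The squared modulus as an element of [R], where order and integration live; the norm of [R[i]]
    would give a complex number. The same holds for [sqdist]. *)
Definition sqnormc {R : realType} (c : R[i]) : R :=
  complex.Re c ^+ 2 + complex.Im c ^+ 2.

Definition sqdist {R : realType} (c : R[i]) (z : circle R) : R :=
  (complex.Re (cval z) - complex.Re c) ^+ 2 +
  (complex.Im (cval z) - complex.Im c) ^+ 2.

Lemma sqnormcE (R : realType) (c : R[i]) : (sqnormc c)%:C = `|c| ^+ 2.
Proof. exact: add_Re2_Im2. Qed.

Lemma sqdistE (R : realType) (c : R[i]) z :
  (sqdist c z)%:C = `|cval z - c| ^+ 2.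
Proof. by rewrite -add_Re2_Im2 /sqdist; case: c (cval z) => [? ?] [? ?]. Qed.

Lemma trig_poly_sqdist (R : realType) (c : R[i]) : trig_poly (sqdist c).
Proof.
apply: trig_polyD; apply: trig_polyX; apply: trig_polyB;
  do [exact: trig_poly_cst|exact: trig_poly_Re|exact: trig_poly_Im].
Qed.

Lemma bounded_measurable_sqdist (R : realType) (c : R[i]) :
  bounded_measurable (sqdist c : borel_circle R -> R).
Proof. exact/trig_poly_bounded_measurable/trig_poly_sqdist. Qed.

(** On the circle [|z - c|^2 = 1 + |c|^2 - conj(c) z - c conj(z)], so the left side combines three
    neighbouring powers of [c] or of its conjugate. They cancel when [k] and [l] differ, and leave
    [1 - |c|^2] when [k = l]. *)
Lemma cintegral_sqdist_monomial (R : realType) (mu nu : circle_prob R) c k l :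
  (forall n, (0 < n)%N -> moment mu n = c ^+ n) ->
  (forall n, (0 < n)%N -> moment nu n = 0) ->
  cintegral mu (fun z => (sqdist c z)%:C * circle_monomial k l z) =
  (1 - sqnormc c)%:C * cintegral nu (circle_monomial k l).
Proof.
move=> muc nu0; have bm i j := @cbounded_measurable_monomial R i j.
(* Zero moments are powers of [0], so [cintegral_monomial] applies to [nu] as well; the convention
   [0^0 = 1] supplies the diagonal term. *)
have nu00 n : (0 < n)%N -> moment nu n = 0 ^+ n.
  by case: n => // n n0; rewrite nu0// expr0n.
have bk (a : R[i]) i j : cbounded_measurable (fun z => a * circle_monomial i j z).
  by apply: cbounded_measurableM => //; exact: cbounded_measurable_cst.
rewrite (_ : (fun z => _) = fun z => (1 + c * c^*) * circle_monomial k l z +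
    (- c^* * circle_monomial k.+1 l z + - c * circle_monomial k l.+1 z)); last first.
  apply/funext => z; rewrite sqdistE sqr_normc rmorphB/= /circle_monomial.
  rewrite !exprS; have := circle_mulJ z.
  set v := cval z; set w := conjc v; set d := conjc c.
  by move=> <-; ring.
rewrite cintegralD//; last exact: cbounded_measurableD.
rewrite cintegralD// !cintegralZ// !(cintegral_monomial _ _ muc).
rewrite (cintegral_monomial _ _ nu00) rmorphB/= sqnormcE sqr_normc rmorph0.
rewrite rmorph1; set d := conjc c.
(* In each case the truncated differences of exponents are made explicit, after which the identity
   is a ring identity. *)
have [lk|kl|->] := ltngtP k l.
- rewrite -(subnKC lk); set m := (l - k.+1)%N.
  have -> : (k - (k.+1 + m) = 0)%N by lia.
  have -> : (k.+1 - (k.+1 + m) = 0)%N by lia.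
  have -> : (k - (k.+1 + m).+1 = 0)%N by lia.
  have -> : (k.+1 + m - k = m.+1)%N by lia.
  have -> : (k.+1 + m - k.+1 = m)%N by lia.
  have -> : ((k.+1 + m).+1 - k = m.+2)%N by lia.
  by rewrite expr0n/= !exprS expr0; ring.
- rewrite -(subnKC kl); set m := (k - l.+1)%N.
  have -> : (l.+1 + m - l = m.+1)%N by lia.
  have -> : (l - (l.+1 + m) = 0)%N by lia.
  have -> : ((l.+1 + m).+1 - l = m.+2)%N by lia.
  have -> : (l - (l.+1 + m).+1 = 0)%N by lia.
  have -> : (l.+1 + m - l.+1 = m)%N by lia.
  have -> : (l.+1 - (l.+1 + m) = 0)%N by lia.
  by rewrite expr0n/= !exprS expr0; ring.
- by rewrite !subnn subSnn (_ : l - l.+1 = 0)%N ?expr0 ?expr1; [ring|lia].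
Qed.

Lemma Rintegral_trig_poly_sqdist (R : realType) (mu nu : circle_prob R) c f :
  (forall n, (0 < n)%N -> moment mu n = c ^+ n) ->
  (forall n, (0 < n)%N -> moment nu n = 0) -> trig_poly f ->
  \int[mu]_z (f z * sqdist c z) = (1 - sqnormc c) * \int[nu]_z f z.
Proof.
move=> muc nu0; apply: trig_poly_Rintegral; first exact: bounded_measurable_sqdist.
by move=> k l; exact: cintegral_sqdist_monomial.
Qed.

(** The case [f = 1] of the weighted identity. It yields [|c| <= 1], and a vanishing integral when
    [|c| = 1]. *)
Lemma Rintegral_sqdist (R : realType) (mu nu : circle_prob R) c :
  (forall n, (0 < n)%N -> moment mu n = c ^+ n) ->
  (forall n, (0 < n)%N -> moment nu n = 0) ->
  \int[mu]_z sqdist c z = 1 - sqnormc c.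
Proof.
move=> muc nu0; have := Rintegral_trig_poly_sqdist muc nu0 (trig_poly_cst 1).
rewrite Rintegral_cst// [X in fine X]probability_setT/= !mulr1 => <-.
by apply: eq_Rintegral => z _; rewrite mul1r.
Qed.

Lemma sqdist_ge0 (R : realType) (c : R[i]) z : 0 <= sqdist c z.
Proof. by rewrite addr_ge0// sqr_ge0. Qed.

(** A nonnegative function with zero integral vanishes almost everywhere, and [|z - c|^2] vanishes
    only at [c]; so every Borel set that misses [c] is negligible. *)
Lemma measure_eq_dirac (R : realType) (mu : circle_prob R) (c : borel_circle R) :
  \int[mu]_z sqdist (cval c) z = 0 -> measure_eq mu \d_c.
Proof.
move=> mu0.
have ig := bounded_measurable_integrable mu (bounded_measurable_sqdist (cval c)).
have : (\int[mu]_z `|(sqdist (cval c) z)%:E| = 0)%E.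
  under eq_integral do rewrite gee0_abs ?lee_fin ?sqdist_ge0//.
  rewrite -[LHS]fineK; last exact: (integrable_fin_num _ ig).
  by rewrite -[X in X%:E]/(\int[mu]_z sqdist (cval c) z) mu0.
move=> /ae_eq_integral_abs -/(_ measurableT (measurable_int _ ig))[N [mN N0 Nsub]].
have cN z : z != c -> N z.
  move=> zc; apply: Nsub => /= /(_ I)[] /eqP.
  rewrite paddr_eq0 ?sqr_ge0// !sqrf_eq0 !subr_eq0 => /andP[/eqP e1 /eqP e2].
  case/negP: zc; apply/eqP/val_inj; apply/eqP; rewrite eq_complex.
  by rewrite -!/(cval _) e1 e2 !eqxx.
have negl (E : set (borel_circle R)) : measurable E -> ~ E c -> mu E = 0%E.
  move=> mE Ec; apply: (subset_measure0 mE mN _ N0) => z Ez.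
  by apply: cN; apply/eqP => zc; apply: Ec; rewrite -zc.
move=> E mE; rewrite diracE; have [/set_mem cE|/negP cE] := boolP (c \in E).
  have /(congr1 (fun x => 1 - x)%E) : mu (~` E) = 0%E.
    by apply: negl; [exact: measurableC|exact].
  by rewrite -probability_setC ?setCK ?sube0//; exact: measurableC.
by apply: negl => // Ec; apply: cE; exact: mem_set.
Qed.

(** * The Poisson density and the approximation of quadrants *)

Lemma density_measure d (T : measurableType d) (R : realType)
    (mu : {measure set T -> \bar R}) (f : T -> \bar R) :
  measurable_fun setT f -> (forall x, 0 <= f x)%E ->
  exists m : {measure set T -> \bar R},
    forall E, m E = (\int[mu]_(x in E) f x)%E.
Proof.
move=> mf f0; pose m E := (\int[mu]_(x in E) f x)%E.
have m0 : m set0 = 0%E by exact: integral_set0.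
have mge0 E : (0 <= m E)%E by apply: integral_ge0 => x _; exact: f0.
have msig : semi_sigma_additive m.
  move=> F mF tF mUF; rewrite /m ge0_integral_bigcup//; last exact: measurable_funTS.
  by apply: is_cvg_ereal_nneg_natsum_cond => n _ _; exact: mge0.
pose M := isMeasure.Build _ _ _ m m0 mge0 msig.
pose mm : {measure set T -> \bar R} := HB.pack m M.
by exists mm.
Qed.

(** With [r = |c| < 1], the weight lies between [(1 - r)^2] and [(1 + r)^2 < 4]. The uniform lower
    bound keeps the Poisson density bounded; the upper bound makes [1 - |z - c|^2 / 8] a nonnegative
    ratio. *)
Lemma sqdist_bounds (R : realType) (c : R[i]) (z : circle R) :
  sqnormc c < 1 -> (1 - Num.sqrt (sqnormc c)) ^+ 2 <= sqdist c z < 8.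
Proof.
move=> c1; have n0 : 0 <= sqnormc c by rewrite addr_ge0 ?sqr_ge0.
have := sqr_sqrtr n0; have := sqrtr_ge0 (sqnormc c).
have : Num.sqrt (sqnormc c) < 1 by rewrite -sqrtr1 ltr_sqrt.
move: (Num.sqrt _) => r r1 r0 rE.
have : (sqnormc (cval z))%:C = 1 by rewrite sqnormcE circle_norm expr1n.
move=> /(congr1 (@complex.Re R))/=.
move: rE c1; rewrite /sqdist /sqnormc.
case: c (cval z) {n0} => a b [x y] /= rE c1 xy.
(* Cauchy-Schwarz, from the identity [(xa + yb)^2 + (xb - ya)^2 = (x^2 + y^2) (a^2 + b^2)]. *)
have : `|x * a + y * b| <= r.
  rewrite -(ler_pXn2r (n := 2)) ?nnegrE// real_normK ?num_real//.
  rewrite rE -[leRHS]mul1r -xy.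
  have := sqr_ge0 (x * b - y * a); nra.
by rewrite ler_norml => /andP[h1 h2]; apply/andP; split; nra.
Qed.

(** The Poisson kernel computed as a quotient in [R], without the detour through [R[i]]. *)
Definition poisson_density {R : realType} (c : R[i]) (z : circle R) : R :=
  (1 - sqnormc c) / sqdist c z.

Lemma poisson_kernelE (R : realType) (c : R[i]) :
  poisson_kernel c =1 poisson_density c.
Proof.
move=> z; rewrite /poisson_kernel /poisson_density -sqnormcE -sqdistE.
by rewrite -fmorphV -rmorphB -rmorphM.
Qed.

Lemma poisson_density_itv (R : realType) (c : R[i]) z : sqnormc c < 1 ->
  0 <= poisson_density c z <=
    (1 - sqnormc c) / (1 - Num.sqrt (sqnormc c)) ^+ 2.
Proof.
move=> c1; have /andP[g0 _] := sqdist_bounds z c1.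
have r1 : Num.sqrt (sqnormc c) < 1 by rewrite -sqrtr1 ltr_sqrt.
have r2 : 0 < (1 - Num.sqrt (sqnormc c)) ^+ 2 by rewrite exprn_gt0// subr_gt0.
have gp := lt_le_trans r2 g0.
rewrite divr_ge0 ?subr_ge0 ?(ltW gp) ?(ltW c1)//=.
by rewrite ler_pM2l ?subr_gt0// lef_pV2.
Qed.

Lemma bounded_measurable_poisson_density (R : realType) (c : R[i]) :
  sqnormc c < 1 ->
  bounded_measurable (poisson_density c : borel_circle R -> R).
Proof.
move=> c1; split.
  apply: measurable_funM; first exact: measurable_cst.
  (* The reciprocal of a nonnegative number is its real power of exponent [-1], and real powers are
     measurable. *)
  under eq_fun do rewrite -powR_inv1 ?sqdist_ge0//.
  apply: (measurableT_comp (measurable_powR _)).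
  exact: (bounded_measurable_sqdist c).1.
exists ((1 - sqnormc c) / (1 - Num.sqrt (sqnormc c)) ^+ 2) => z.
by have /andP[p0 p1] := poisson_density_itv z c1; rewrite ger0_norm.
Qed.

(* Truncated Neumann series of the reciprocal of [sqdist c / 8]. *)
Lemma sqdist_neumann (R : realType) (c : R[i]) n :
  exists2 s : circle R -> R, trig_poly s &
    forall z, 1 - (1 - sqdist c z / 8) ^+ n = s z * sqdist c z.
Proof.
elim: n => [|n [s ts sE]].
  exists (fun=> 0); first exact: trig_poly_cst.
  by move=> z; rewrite expr0 subrr mul0r.
exists (fun z => 8^-1 + (1 - sqdist c z * 8^-1) * s z).
  apply: trig_polyD; first exact: trig_poly_cst.
  apply: trig_polyM => //; apply: trig_polyB; first exact: trig_poly_cst.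
  by apply: trig_polyM; [exact: trig_poly_sqdist|exact: trig_poly_cst].
move=> z; transitivity
  (8^-1 * sqdist c z + (1 - sqdist c z * 8^-1) * (s z * sqdist c z)).
  by rewrite -sE exprS; ring.
by ring.
Qed.

Lemma trig_poly_step (R : realType) n (f : circle R -> R) :
  trig_poly f -> trig_poly (fun z => step_poly n (f z)).
Proof.
move=> tf; apply: trig_polyX; apply: trig_polyB; first exact: trig_poly_cst.
exact: trig_polyX.
Qed.

(* Maps [-1, 1] into [0, 1] and [a] to the jump [1/2] of [step_poly]. *)
Definition threshold {R : realType} (a x : R) : R :=
  2^-1 - (x - a) * (2 * (1 + `|a|))^-1.

Lemma threshold_itv (R : realType) (a x : R) :
  `|x| <= 1 -> 0 <= threshold a x <= 1.
Proof.
move=> x1; have a0 : 0 < 2 * (1 + `|a|) by rewrite mulr_gt0// ltr_pwDl.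
have : `|x - a| <= 1 + `|a| by rewrite (le_trans (ler_normB _ _))// lerD2r.
rewrite ler_norml => /andP[h1 h2].
have : (x - a) * (2 * (1 + `|a|))^-1 <= 2^-1.
  by rewrite ler_pdivrMr//; lra.
have : - 2^-1 <= (x - a) * (2 * (1 + `|a|))^-1.
  by rewrite ler_pdivlMr//; lra.
by rewrite /threshold => h3 h4; apply/andP; split; lra.
Qed.

Lemma threshold_lt (R : realType) (a x : R) :
  (threshold a x < 2^-1) = (a < x).
Proof.
have a0 : 0 < (2 * (1 + `|a|))^-1 by rewrite invr_gt0 mulr_gt0// ltr_pwDl.
by rewrite /threshold ltrBlDr ltrDl pmulr_lgt0// subr_gt0.
Qed.

Lemma trig_poly_threshold (R : realType) (a : R) (f : circle R -> R) :
  trig_poly f -> trig_poly (fun z => threshold a (f z)).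
Proof.
move=> tf; apply: trig_polyB; first exact: trig_poly_cst.
apply: trig_polyM; last exact: trig_poly_cst.
by apply: trig_polyB => //; exact: trig_poly_cst.
Qed.

(** Step polynomials in the two coordinates have a product tending to the indicator. A truncated
    Neumann series [s n] of the reciprocal weight brings in the factor [sqdist c], since
    [s n * sqdist c] tends to [1]. *)
Lemma quadrant_approx (R : realType) (c : R[i]) (a b : R) : sqnormc c < 1 ->
  exists q : nat -> circle R -> R, [/\ forall n, trig_poly (q n),
    forall n z, `|q n z * sqdist c z| <= 1 &
    forall z : borel_circle R,
      q n z * sqdist c z @[n --> \oo] --> (\1_(quadrant a b) z : R)].
Proof.
move=> c1; pose x (z : circle R) := threshold a (complex.Re (cval z)).
pose y (z : circle R) := threshold b (complex.Im (cval z)).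
have /choice[s sP] n : exists s : circle R -> R, trig_poly s /\
    forall z, 1 - (1 - sqdist c z / 8) ^+ n = s z * sqdist c z.
  by have [s ? ?] := sqdist_neumann c n; exists s.
have x01 z := threshold_itv a (circle_Re_norm1 z).
have y01 z := threshold_itv b (circle_Im_norm1 z).
have r1 : Num.sqrt (sqnormc c) < 1 by rewrite -sqrtr1 ltr_sqrt.
(* The Neumann ratio is strictly below [1] because [|c| < 1] keeps the weight away from zero. *)
have g01 z : 0 <= 1 - sqdist c z / 8 < 1.
  have /andP[g0 g8] := sqdist_bounds z c1.
  have r2 : 0 < (1 - Num.sqrt (sqnormc c)) ^+ 2 by rewrite exprn_gt0// subr_gt0.
  by apply/andP; split; lra.
have qE n z : step_poly n (x z) * step_poly n (y z) * s n z * sqdist c z =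
    step_poly n (x z) * step_poly n (y z) * (1 - (1 - sqdist c z / 8) ^+ n).
  by rewrite (sP n).2 mulrA.
exists (fun n z => step_poly n (x z) * step_poly n (y z) * s n z); split.
- move=> n; apply: trig_polyM; last exact: (sP n).1.
  apply: trig_polyM; apply/trig_poly_step/trig_poly_threshold.
    exact: trig_poly_Re.
  exact: trig_poly_Im.
- move=> n z; rewrite qE !normrM.
  have /andP[x0 x1] := step_poly_itv n (x01 z).
  have /andP[y0 y1] := step_poly_itv n (y01 z).
  have /andP[g0 g1] := g01 z.
  have gn0 : 0 <= (1 - sqdist c z / 8) ^+ n by rewrite exprn_ge0.
  have gn1 : (1 - sqdist c z / 8) ^+ n <= 1 by rewrite exprn_ile1// ltW.
  rewrite !ger0_norm// ?subr_ge0//.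
  by rewrite mulr_ile1 ?mulr_ile1 ?mulr_ge0 ?subr_ge0// gerBl.
- move=> z; under eq_fun do rewrite qE.
  have -> : (\1_(quadrant a b) z : R) =
      (x z < 2^-1)%R%:R * (y z < 2^-1)%R%:R * (1 - 0).
    rewrite /x /y !threshold_lt subr0 mulr1 -natrM mulnb indicE; congr (_%:R).
    by congr nat_of_bool; apply/idP/idP => [/set_mem[-> ->]//|/andP[? ?]];
      exact/mem_set.
  apply: cvgM; first apply: cvgM.
  - exact: cvg_step_poly (x01 z).
  - exact: cvg_step_poly (y01 z).
  apply: cvgB; first exact: cvg_cst.
  have /andP[g0 g1] := g01 z.
  by apply: cvg_expr; rewrite ger0_norm.
Qed.

(** For a trigonometric polynomial [q], the integral of [q |z - c|^2] against [mu] equals the one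
    against the Poisson density times [nu]. Letting these products tend to the indicator of a
    quadrant, both measures agree on a generating pi-system. *)
Lemma measure_eq_poisson (R : realType) (mu nu : circle_prob R) c :
  (forall n, (0 < n)%N -> moment mu n = c ^+ n) ->
  (forall n, (0 < n)%N -> moment nu n = 0) -> sqnormc c < 1 ->
  measure_eq mu (fun E => \int[nu]_(z in E) (poisson_density c z)%:E)%E.
Proof.
move=> muc nu0 c1.
have bp := bounded_measurable_poisson_density c1.
have p0 z : 0 <= poisson_density c z by case/andP: (poisson_density_itv z c1).
(* [measure_unique] compares two measures, so the set function given by the density is first bundled
   as a measure [m]. *)
have [|m mE] := @density_measure _ _ _ nu (fun z => (poisson_density c z)%:E) _
  (fun z => p0 z).
  by apply/measurable_EFinP; case: bp.
move=> E mesE; rewrite -mE.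
apply: (measure_unique (quadrants R) (fun=> setT)) => //.
- exact: sigma_quadrants.
- exact: setI_closed_quadrants.
- by move=> _; exists (-2), (-2); rewrite quadrantT.
- by rewrite bigcup_const.
- move=> _ [a [b ->]]; set G := quadrant a b.
  have mG : measurable G by exact: measurable_quadrant.
  have b1 : bounded_measurable (\1_G : borel_circle R -> R).
    split; first exact: measurable_indic.
    by exists 1 => z; rewrite indicE; case: (_ \in _); rewrite ?normr1 ?normr0.
  have b1p := bounded_measurableM b1 bp.
  have [q [tq qg1 qcvg]] := quadrant_approx a b c1.
  have bg := bounded_measurable_sqdist c.
  have bq n : bounded_measurable
      (fun z : borel_circle R => q n z * sqdist c z).
    by apply: bounded_measurableM bg; exact/trig_poly_bounded_measurable/tq.
  have cvmu : \int[mu]_z (q n z * sqdist c z) @[n --> \oo] -->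
      \int[mu]_z (\1_G z : R).
    apply: (bounded_cvg_Rintegral (K := 1)) => //.
    by move=> n; case: (bq n).
  have cvnu : \int[nu]_z (q n z * sqdist c z * poisson_density c z) @[n --> \oo]
      --> \int[nu]_z (\1_G z * poisson_density c z).
    have [_ [M pM]] := bp; apply: (bounded_cvg_Rintegral (K := M)).
    + by move=> n; case: (bounded_measurableM (bq n) bp).
    + by case: b1p.
    + move=> n z; rewrite normrM (le_trans _ (pM z))//.
      by rewrite ler_piMl.
    + by move=> z; apply: cvgM; [exact: qcvg|exact: cvg_cst].
  (* The weight cancels the denominator of the Poisson density, leaving the constant [1 - |c|^2] of
     the weighted identity. *)
  have eqn n : \int[nu]_z (q n z * sqdist c z * poisson_density c z) =
      \int[mu]_z (q n z * sqdist c z).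
    rewrite (Rintegral_trig_poly_sqdist muc nu0)// -RintegralZl//; last first.
      exact/bounded_measurable_integrable/trig_poly_bounded_measurable/tq.
    apply: eq_Rintegral => z _; rewrite /poisson_density.
    have /andP[+ _] := sqdist_bounds z c1 => g0.
    have gp : sqdist c z != 0.
      rewrite gt_eqF// (lt_le_trans _ g0)// exprn_gt0// subr_gt0.
      by rewrite -sqrtr1 ltr_sqrt.
    by rewrite mulrCA -mulrA mulfV ?mulr1// mulrC.
  transitivity (\int[mu]_z (\1_G z : R))%:E.
    rewrite /Rintegral fineK; last exact/integrable_fin_num/bounded_measurable_integrable.
    by rewrite integral_indic// setIT.
  rewrite mE integral_mkcond; transitivity (\int[nu]_z (\1_G z * poisson_density c z))%:E.
    move: cvnu; rewrite (funext eqn) => cvnu.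
    by congr EFin; exact: cvg_unique cvmu cvnu.
  rewrite /Rintegral fineK; last exact/integrable_fin_num/bounded_measurable_integrable.
  apply: eq_integral => z _; rewrite patchE indicE.
  by case: ifP; rewrite ?mul1r ?mul0r.
- by move=> _; rewrite [ltLHS]probability_setT ltry.
Qed.

(** * Dichotomy according to the modulus of the mean *)

Theorem proposition6p3 (R : realType) (mu : circle_prob R) :
  cintegral mu (@cval R) != 0 ->
  cfree_infinitely_divisible (mu, haar R) ->
  (exists lambda : borel_circle R, measure_eq mu \d_lambda) \/
  (exists alpha : R[i],
     [/\ `|alpha| < 1, alpha != 0 &
         measure_eq mu
           (fun E => \int[haar R]_(z in E) (poisson_kernel alpha z)%:E)%E]).
Proof.
move=> mu1 muid; have haar1 := cintegral_haar_cval R.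
set c := cintegral mu (@cval R) in mu1.
have muc n n0 := (@infinitely_divisible_moments R mu (haar R) n haar1 muid n0).2.
have nu0 n n0 := (@infinitely_divisible_moments R mu (haar R) n haar1 muid n0).1.
have intE := Rintegral_sqdist muc nu0.
(* [1 - |c|^2] is the integral of the nonnegative function [|z - c|^2]. *)
have : sqnormc c <= 1.
  by rewrite -subr_ge0 -intE Rintegral_ge0// => z _; exact: sqdist_ge0.
rewrite le_eqVlt => /predU1P[c1|c1].
  left.
  have cT : (c : (R[i] : numFieldType)) \in circle_set R.
    rewrite inE /circle_set/=; apply/eqP.
    by rewrite -(@pexpr_eq1 _ _ 2)// -sqnormcE c1.
  exists (exist _ c cT); apply: measure_eq_dirac.
  by rewrite intE c1 subrr.
right; exists c; split=> //.
  by rewrite -(@expr_lt1 _ 2)// -sqnormcE ltcR.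
move=> E mE; rewrite (measure_eq_poisson muc nu0 c1 mE).
by apply: eq_integral => z _; rewrite poisson_kernelE.
Qed.
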